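(* The set $$\lambda(\mathcal{S}^{4,2})=\{(\lambda_{\sigma_1}(X),\lambda_{\sigma_2}(X),\lambda_{\sigma_3}(X),\lambda_{\sigma_4}(X)) : X\in\mathcal{S}^{4,2},\ \sigma\in S_4\}\subset\mathbb{R}^4$$ of eigenvalue vectors of $2$-locally PSD matrices in $\mathrm{Sym}_4$ is not convex.
   Context: $\mathrm{Sym}_n$ denotes the space of $n\times n$ real symmetric matrices. A matrix in $\mathrm{Sym}_n$ is positive semidefinite (PSD) if all its eigenvalues are nonnegative. For $k\in\{1,\dots,n\}$, $\mathcal{S}^{n,k}$ denotes the set of matrices $X\in\mathrm{Sym}_n$ all of whose $k\times k$ principal submatrices are positive semidefinite; such matrices are called $k$-locally PSD. For $X\in\mathrm{Sym}_n$, $\lambda_1(X)\ge\dots\ge\lambda_n(X)$ are the eigenvalues of $X$ in decreasing order, counted with multiplicity. $S_n$ is the group of permutations of $\{1,\dots,n\}$, and $\sigma_i=\sigma(i)$ for $\sigma\in S_n$. *)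

(* Defs.v *)
From mathcomp Require Import all_boot all_order perm all_algebra.
From mathcomp Require Import boolp classical_sets reals convex.

Set Implicit Arguments.
Unset Strict Implicit.
Unset Printing Implicit Defensive.

Import Order.TTheory GRing.Theory Num.Theory.

Local Open Scope classical_set_scope.
Local Open Scope ring_scope.

Definition psd (R : realType) (n : nat) (A : 'M[R]_n) : Prop :=
  A \is symmetricmx /\ forall a : R, eigenvalue A a -> 0 <= a.

(* A k x k principal submatrix is given by k row/column indices listed in
   strictly increasing order. *)
Definition locally_psd (R : realType) (n k : nat) : set 'M[R]_n :=
  [set X | X \is symmetricmx /\
     forall f : 'I_k -> 'I_n,
       (forall i j : 'I_k, (i < j)%N -> (f i < f j)%N) ->
       psd (mxsub f f X)].

(* lam lists the eigenvalues of X with (algebraic) multiplicity, in decreasing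
   order. Such a lam is unique, and for symmetric X it exists by the spectral
   theorem. *)
Definition ordered_eigenvalues (R : realType) (n : nat)
    (X : 'M[R]_n) (lam : 'I_n -> R) : Prop :=
  char_poly X = \prod_(i < n) ('X - (lam i)%:P) /\
  (forall i j : 'I_n, (i <= j)%N -> lam j <= lam i).

Definition eigenvalue_vectors (R : realType) (n : nat) (S : set 'M[R]_n) :
    set 'rV[R]_n :=
  [set v | exists (X : 'M[R]_n) (lam : 'I_n -> R) (s : 'S_n),
     [/\ S X, ordered_eigenvalues X lam & v = \row_(i < n) lam (s i)]].

(* Main.v *)
Require Import Defs.
From mathcomp Require Import all_boot all_order perm all_algebra.
From mathcomp Require Import boolp classical_sets reals interval_inference convex.
From mathcomp Require Import ring lra.

(** Write e_2 and e_4 for the elementary symmetric functions of the four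
    eigenvalues of a 2-locally PSD matrix X. Then e_4 = \det X, and e_2 is the
    sum of the six 2 x 2 principal minors of X, which are all nonnegative.

    The obstruction to convexity is the inequality e_4 <= e_2 ^+ 2
    ([eigenvalue_vectors44_prod_le]). It follows from the stronger bound of
    \det X by the sum, over the three perfect matchings {ij, kl} of the
    complete graph on the indices, of the product of the minors of ij and kl
    ([det_le_matching_minors]). To obtain the latter, write the entries as
    d_i * d_j * y_ij with d_i ^+ 2 the diagonal entries and |y_ij| <= 1. The
    difference of the two sides is then twice (d_0 d_1 d_2 d_3) ^+ 2 times
      1 - (sum of the y-products along the 4 triangles)
        + (sum of the y-products along the 3 Hamiltonian cycles),
    a polynomial of degree one in each y_ij, so its minimum over the cube
    [-1, 1]^6 is attained at a vertex. At a vertex let s be the sum of the four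
    triangle products, which are signs. Each edge lies in two triangles, so
    these signs multiply to 1 and s is 4, 0 or -4; a cycle product is the
    product of two triangle signs, so the polynomial is
    1 - s + (s ^+ 2 - 4) / 4 = s * (s - 4) / 4 >= 0.

    Convexity would contradict this inequality as follows. Start from a point p
    of the set with e_2 = 0 and e_4 = 0 and move towards a point q so that e_4
    becomes positive to first order. Along the segment e_4 grows linearly and
    e_2 ^+ 2 only quadratically, so the segment leaves the set near p. Take
    p = (2, 2, 0, -1), from the 3 x 3 matrix with diagonal 1 and all other
    entries -1, bordered by zeros, and q = (9, 9, -1, -1), from four times the
    identity plus a 4-cycle of weights 4, 3, 4, -3, whose square is 25 times
    the identity. The set is stable under nonnegative scaling, so instead of
    p one can use 30 * p, and then the midpoint is close enough to the ray
    through p. *)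

Set Implicit Arguments.
Unset Strict Implicit.
Unset Printing Implicit Defensive.

Import Order.TTheory GRing.Theory Num.Theory.

Local Open Scope ring_scope.

(** * Explicit determinants and characteristic polynomials *)

(* Rows and columns are indexed by natural numbers, so that entries at numeric
   positions reduce by computation. *)
Local Notation "f ^[ i , j ]" := (f i%N j%N)
  (at level 2, left associativity, only parsing).

(** Determinant of the leading 4 x 4 block of f, by cofactor expansion. *)
Definition laplace44 (R : comNzRingType) (f : nat -> nat -> R) : R :=
    f^[0, 0] * (f^[1, 1] * (f^[2, 2] * f^[3, 3] - f^[2, 3] * f^[3, 2])
           - f^[1, 2] * (f^[2, 1] * f^[3, 3] - f^[2, 3] * f^[3, 1])
           + f^[1, 3] * (f^[2, 1] * f^[3, 2] - f^[2, 2] * f^[3, 1]))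
  - f^[0, 1] * (f^[1, 0] * (f^[2, 2] * f^[3, 3] - f^[2, 3] * f^[3, 2])
           - f^[1, 2] * (f^[2, 0] * f^[3, 3] - f^[2, 3] * f^[3, 0])
           + f^[1, 3] * (f^[2, 0] * f^[3, 2] - f^[2, 2] * f^[3, 0]))
  + f^[0, 2] * (f^[1, 0] * (f^[2, 1] * f^[3, 3] - f^[2, 3] * f^[3, 1])
           - f^[1, 1] * (f^[2, 0] * f^[3, 3] - f^[2, 3] * f^[3, 0])
           + f^[1, 3] * (f^[2, 0] * f^[3, 1] - f^[2, 1] * f^[3, 0]))
  - f^[0, 3] * (f^[1, 0] * (f^[2, 1] * f^[3, 2] - f^[2, 2] * f^[3, 1])
           - f^[1, 1] * (f^[2, 0] * f^[3, 2] - f^[2, 2] * f^[3, 0])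
           + f^[1, 2] * (f^[2, 0] * f^[3, 1] - f^[2, 1] * f^[3, 0])).

Lemma det_mx44 (R : comNzRingType) (f : nat -> nat -> R) :
  \det (\matrix_(i < 4, j < 4) f i j) = laplace44 f.
Proof.
rewrite (expand_det_row _ ord0) !big_ord_recl big_ord0 /cofactor.
rewrite !(expand_det_row _ ord0) !big_ord_recl !big_ord0 /cofactor.
rewrite !(expand_det_row _ ord0) !big_ord_recl !big_ord0 /cofactor !det_mx11.
rewrite !mxE /= !addr0 /bump /= /addn /= /laplace44; ring.
Qed.

Lemma char_poly_mx44 (R : comNzRingType) (f : nat -> nat -> R) :
  char_poly (\matrix_(i < 4, j < 4) f i j) =
  laplace44 (fun i j => 'X *+ (i == j) - (f i j)%:P).
Proof.
by rewrite -det_mx44; congr (\det _); apply/matrixP=> i j; rewrite !mxE.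
Qed.

(** Evaluating before expanding keeps all computations in R: an expansion in
    {poly R} would have to be evaluated monomial by monomial. *)
Lemma horner_char_poly44 (R : comNzRingType) (f : nat -> nat -> R) t :
  (char_poly (\matrix_(i < 4, j < 4) f i j)).[t] =
  laplace44 (fun i j => t *+ (i == j) - f i j).
Proof.
rewrite -det_mx44 -horner_evalE -det_map_mx; congr (\det _).
by apply/matrixP=> i j; rewrite !mxE /= horner_evalE !hornerE hornerMn hornerX.
Qed.

Lemma eigenvalue_mx22 (F : fieldType) (M : 'M[F]_2) a :
  eigenvalue M a =
  ((a - M ord0 ord0) * (a - M ord_max ord_max)
    == M ord0 ord_max * M ord_max ord0).
Proof.
rewrite eigenvalue_root_char rootE /char_poly (expand_det_row _ ord0).
rewrite !big_ord_recl big_ord0 /cofactor !det_mx11 !mxE /=.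
rewrite (_ : lift ord0 ord0 = ord_max); last exact: val_inj.
rewrite (_ : lift ord_max ord0 = ord0); last exact: val_inj.
rewrite !hornerE /= -[RHS]subr_eq0; congr (_ == 0); ring.
Qed.

(** * Local positivity in terms of entries *)

Lemma symmetricmxP (R : fieldType) n (A : 'M[R]_n) :
  reflect (forall i j, A i j = A j i) (A \is symmetricmx).
Proof.
rewrite qualifE /= expr0 scale1r.
apply: (iffP eqP) => [AE i j|AE]; first by rewrite {1}AE !mxE.
by apply/matrixP => i j; rewrite !mxE.
Qed.

(** The eigenvalues are the roots of (t - a) * (t - c) = b ^+ 2. If a, c and
    a * c - b ^+ 2 are nonnegative, a negative t makes the left side too large.
    Conversely the smaller root is real, so its nonnegativity bounds the
    square root of the discriminant by the trace. *)
Lemma psd_mx22P (R : realType) (M : 'M[R]_2) : psd M <->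
  [/\ M \is symmetricmx, 0 <= M ord0 ord0, 0 <= M ord_max ord_max &
      M ord0 ord_max ^+ 2 <= M ord0 ord0 * M ord_max ord_max].
Proof.
split=> [[Ms ev]|[Ms a0 c0 b2]]; last first.
  split=> // t; rewrite eigenvalue_mx22 -(symmetricmxP _ Ms ord0) => /eqP te.
  by case: (lerP 0 t) => // t0; nra.
have Mb := symmetricmxP _ Ms ord0 ord_max.
set a := M ord0 ord0; set b := M ord0 ord_max; set c := M ord_max ord_max.
have root_ge0 t : (t - a) * (t - c) = b * b -> 0 <= t.
  by move=> tab; apply: ev; rewrite eigenvalue_mx22 -Mb tab.
pose s := Num.sqrt ((a - c) ^+ 2 + 4 * b ^+ 2).
have s2 : s ^+ 2 = (a - c) ^+ 2 + 4 * b ^+ 2.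
  by rewrite sqr_sqrtr // addr_ge0 ?sqr_ge0 // mulr_ge0 ?sqr_ge0.
have s0 : 0 <= s by exact: sqrtr_ge0.
have r0 : 0 <= (a + c - s) / 2.
  by apply: root_ge0; nra.
have det0 : b ^+ 2 <= a * c by nra.
by split=> //; rewrite -/a -/b -/c; nra.
Qed.

Lemma locally_psd2P (R : realType) n (X : 'M[R]_n) : @locally_psd R n 2 X <->
  X \is symmetricmx /\ forall i j : 'I_n, (i < j)%N ->
    [/\ 0 <= X i i, 0 <= X j j & X i j ^+ 2 <= X i i * X j j].
Proof.
split=> -[Xs H]; split=> //.
  move=> i j ij; have /H /psd_mx22P[_] : forall k l : 'I_2, (k < l)%N ->
      ((if k == ord0 then i else j) < (if l == ord0 then i else j))%N.
    by move=> [[|[|k]] ?] [[|[|l]] ?].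
  by rewrite !mxE.
move=> f fmono.
have [f0 f1 f01] := H (f ord0) (f ord_max) (fmono ord0 ord_max isT).
apply/psd_mx22P; rewrite !mxE; split=> //.
by apply/symmetricmxP => i j; rewrite !mxE; apply: symmetricmxP.
Qed.

(** * The determinant bound *)

(* Reduces 0 <= E, for E of degree one in the variable y bounded by h, to the
   two cases y = 1 and y = -1. *)
Ltac to_endpoints ext h :=
  match type of h with is_true (`|?y| <= _) =>
    match goal with |- is_true (0 <= ?E) =>
      let G := eval pattern y in E in
      match G with ?F _ => apply: (ext F y h) => /=; first by field end
    end
  end.

(** The variables label the edges 01, 02, 03, 12, 13, 23 of the complete graph
    on four vertices; the sums run over its triangles and its 4-cycles. *)
Lemma triangle_cycle_ge0 (R : realFieldType) (a b c d e f : R) :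
  `|a| <= 1 -> `|b| <= 1 -> `|c| <= 1 ->
  `|d| <= 1 -> `|e| <= 1 -> `|f| <= 1 ->
  0 <= 1 - (a * b * d + a * c * e + b * c * f + d * e * f)
         + (a * d * f * c + a * e * f * b + b * d * e * c).
Proof.
move=> ha hb hc hd he hf.
have ext (F : R -> R) y : `|y| <= 1 ->
    F y = (F 1 + F (-1)) / 2 + (F 1 - F (-1)) / 2 * y ->
    0 <= F 1 -> 0 <= F (-1) -> 0 <= F y.
  by rewrite ler_norml => /andP[? ?] -> ? ?; nra.
to_endpoints ext ha; to_endpoints ext hb; to_endpoints ext hc;
to_endpoints ext hd; to_endpoints ext he; to_endpoints ext hf; lra.
Qed.

(** When a * c = 0 also x = 0, and any y will do; this avoids treating zero
    diagonal entries separately. *)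
Lemma normalized_entry (R : realType) (a c x : R) : 0 <= a -> 0 <= c ->
  x ^+ 2 <= a * c ->
  exists2 y, `|y| <= 1 & x = Num.sqrt a * Num.sqrt c * y.
Proof.
move=> a0 c0 xac.
have xle : `|x| <= Num.sqrt a * Num.sqrt c.
  by rewrite -sqrtrM // -sqrtr_sqr ler_wsqrtr.
have [ac0|ac0] := eqVneq (Num.sqrt a * Num.sqrt c) 0.
  exists 0; first by rewrite normr0.
  by apply/eqP; rewrite mulr0 -normr_le0 -ac0.
exists (x / (Num.sqrt a * Num.sqrt c)); last by rewrite mulrC divfK.
rewrite normrM normfV ler_pdivrMr ?normr_gt0 // mul1r.
by rewrite (le_trans xle) // ler_norm.
Qed.

Definition minor2 (R : pzRingType) (f : nat -> nat -> R) (i j : nat) : R :=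
  f i i * f j j - f i j ^+ 2.

Section Locally_psd_44.
Variables (R : realType) (f : nat -> nat -> R).
Let X : 'M[R]_4 := \matrix_(i, j) f i j.
Local Notation m := (minor2 f).

Hypothesis X_locally_psd : locally_psd 2 X.

Let fC i j : (i < 4)%N -> (j < 4)%N -> f i j = f j i.
Proof.
move=> i4 j4; have [/symmetricmxP Xs _] := X_locally_psd.
by have := Xs (Ordinal i4) (Ordinal j4); rewrite !mxE.
Qed.

Let f_pair i j : (i < j)%N -> (j < 4)%N ->
  [/\ 0 <= f i i, 0 <= f j j & f i j ^+ 2 <= f i i * f j j].
Proof.
move=> ij j4; have /locally_psd2P[_ X_pair] := X_locally_psd.
have := X_pair (Ordinal (ltn_trans ij j4)) (Ordinal j4) ij.
by rewrite !mxE.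
Qed.

Let m_ge0 i j : (i < j)%N -> (j < 4)%N -> 0 <= m i j.
Proof. by move=> ij j4; have [_ _] := f_pair ij j4; rewrite subr_ge0. Qed.

(** Homogeneous form of [triangle_cycle_ge0]. In the permutation expansion of
    the determinant, the products of minors account for the identity (up to a
    multiple), the transpositions and their products; the 3-cycles give the
    triangles and the 4-cycles the Hamiltonian cycles, each counted twice for
    the two orientations. *)
Lemma det_le_matching_minors :
  \det X <= m^[0, 1] * m^[2, 3] + m^[0, 2] * m^[1, 3] + m^[0, 3] * m^[1, 2].
Proof.
pose d i := Num.sqrt (f i i).
have f_entry i j : (i < j)%N -> (j < 4)%N ->
    exists2 y, `|y| <= 1 & f i j = d i * d j * y.
  by move=> ij j4; have [? ? ?] := f_pair ij j4; apply: normalized_entry.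
have f_diag i : (i < 4)%N -> f i i = d i ^+ 2.
  case: i => [|i] i4; rewrite sqr_sqrtr //.
    by case: (@f_pair 0%N 1%N isT isT).
  by case: (@f_pair 0%N i.+1 isT i4).
have [y01 h01 e01] := @f_entry 0%N 1%N isT isT.
have [y02 h02 e02] := @f_entry 0%N 2%N isT isT.
have [y03 h03 e03] := @f_entry 0%N 3%N isT isT.
have [y12 h12 e12] := @f_entry 1%N 2%N isT isT.
have [y13 h13 e13] := @f_entry 1%N 3%N isT isT.
have [y23 h23 e23] := @f_entry 2%N 3%N isT isT.
have G := triangle_cycle_ge0 h01 h02 h03 h12 h13 h23.
rewrite -subr_ge0 /X det_mx44 /laplace44 /minor2.
rewrite (@fC 1%N 0%N) // (@fC 2%N 0%N) // (@fC 3%N 0%N) //.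
rewrite (@fC 2%N 1%N) // (@fC 3%N 1%N) // (@fC 3%N 2%N) //.
rewrite e01 e02 e03 e12 e13 e23.
rewrite (f_diag 0%N) // (f_diag 1%N) // (f_diag 2%N) // (f_diag 3%N) //.
have D := mulr_ge0 (ler0n R 2) (sqr_ge0 (d 0%N * d 1%N * d 2%N * d 3%N)).
(* The difference of the two sides is exactly the product of D and G. *)
apply: le_trans (mulr_ge0 D G) _.
rewrite le_eqVlt; apply/orP; left; apply/eqP; ring.
Qed.

Lemma prod_le_sqr_sum_pairs (g : seq R) :
  char_poly X = \prod_(i < 4) ('X - (g`_i)%:P) ->
  g`_0 * g`_1 * g`_2 * g`_3 <=
  (g`_0 * g`_1 + g`_0 * g`_2 + g`_0 * g`_3 + g`_1 * g`_2 + g`_1 * g`_3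
    + g`_2 * g`_3) ^+ 2.
Proof.
move=> charX.
have horner_charX t : (char_poly X).[t] = \prod_(i < 4) (t - g`_i).
  by rewrite charX horner_prod; apply: eq_bigr => i _; rewrite !hornerE.
have detX : \det X = g`_0 * g`_1 * g`_2 * g`_3.
  have := horner_charX 0; rewrite horner_coef0 char_poly_det.
  by rewrite !big_ord_recr big_ord0 /= => e; ring: e.
(* If P is the characteristic polynomial, the second elementary symmetric
   function is (P(1) + P(-1)) / 2 - 1 - P(0). *)
have e2X : m^[0, 1] + m^[0, 2] + m^[0, 3] + m^[1, 2] + m^[1, 3] + m^[2, 3] =
    g`_0 * g`_1 + g`_0 * g`_2 + g`_0 * g`_3 + g`_1 * g`_2 + g`_1 * g`_3
    + g`_2 * g`_3.
  have := (horner_charX 1, horner_charX (-1), detX).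
  rewrite /X !horner_char_poly44 det_mx44 /laplace44 /=.
  rewrite !big_ord_recr !big_ord0 /= /minor2.
  rewrite (@fC 1%N 0%N) // (@fC 2%N 0%N) // (@fC 3%N 0%N) //.
  rewrite (@fC 2%N 1%N) // (@fC 3%N 1%N) // (@fC 3%N 2%N) //.
  move=> [[e1 eN1] e0]; lra.
have m01 := @m_ge0 0%N 1%N isT isT; have m02 := @m_ge0 0%N 2%N isT isT.
have m03 := @m_ge0 0%N 3%N isT isT; have m12 := @m_ge0 1%N 2%N isT isT.
have m13 := @m_ge0 1%N 3%N isT isT; have m23 := @m_ge0 2%N 3%N isT isT.
rewrite -detX -e2X; apply: le_trans det_le_matching_minors _.
rewrite -subr_ge0; nra.
Qed.

End Locally_psd_44.

Lemma eigenvalue_vectors44_prod_le (R : realType) (g : seq R) :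
  eigenvalue_vectors (@locally_psd R 4 2) (\row_(i < 4) g`_i) ->
  g`_0 * g`_1 * g`_2 * g`_3 <=
  (g`_0 * g`_1 + g`_0 * g`_2 + g`_0 * g`_3 + g`_1 * g`_2 + g`_1 * g`_3
    + g`_2 * g`_3) ^+ 2.
Proof.
move=> [X [lam [s [Xpsd [charX _] /rowP gE]]]].
pose f i j := X (inord i) (inord j).
have XE : X = \matrix_(i < 4, j < 4) f i j.
  by apply/matrixP => i j; rewrite !mxE /f !inord_val.
rewrite XE in Xpsd charX.
apply: (prod_le_sqr_sum_pairs Xpsd); rewrite charX (reindex_perm s) /=.
by apply: eq_bigr => i _; have := gE i; rewrite !mxE => ->.
Qed.

(** * Two points of the set whose midpoint is outside *)

Lemma row_mem_eigenvalue_vectors (R : realType) n (S : set 'M[R]_n)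
    (X : 'M[R]_n) (g : seq R) :
  S X -> char_poly X = \prod_(i < n) ('X - (g`_i)%:P) ->
  (forall i j, (i <= j < n)%N -> g`_j <= g`_i) ->
  eigenvalue_vectors S (\row_(i < n) g`_i).
Proof.
move=> SX charX gmono; exists X, (fun i => g`_i), 1%g; split=> //.
  by split=> // i j ij; apply: gmono; rewrite ij /=.
by apply/rowP => i; rewrite !mxE perm1.
Qed.

(** 30 * (2 * I - J) for the 3 x 3 all-ones matrix J, bordered by zeros: all
    its 2 x 2 principal minors vanish, so e_2 = 0. *)
Definition negative_triangle_entry (R : realType) (i j : nat) : R :=
   (nth [::]
   [:: [:: 30; -30; -30; 0];
       [:: -30; 30; -30; 0];
       [:: -30; -30; 30; 0];
       [:: 0; 0; 0; 0]] i)`_j.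

(** 4 * I + A for a weighted 4-cycle A with one negative edge. The sign makes
    the rows of A orthogonal, so A ^+ 2 = 25 * I and the trace of A being 0
    gives the eigenvalues 5, 5, -5, -5. *)
Definition twisted_cycle_entry (R : realType) (i j : nat) : R :=
   (nth [::]
   [:: [:: 4; 4; 0; -3];
       [:: 4; 4; 3; 0];
       [:: 0; 3; 4; 4];
       [:: -3; 0; 4; 4]] i)`_j.

Ltac concrete_locally_psd entry :=
  apply/locally_psd2P; split; first
    (by apply/symmetricmxP=> -[[|[|[|[|?]]]] ?] [[|[|[|[|?]]]] ?]; rewrite !mxE);
  by move=> [[|[|[|[|?]]]] ?] [[|[|[|[|?]]]] ?] //= _;
     rewrite !mxE /entry /=; split; lra.

Ltac concrete_char_poly entry :=
  rewrite (char_poly_mx44 (entry _)) /laplace44 /entry !big_ord_recr big_ord0 /=;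
  rewrite !(polyCN, polyC_natr, polyC1, polyC0) /=; ring.

Lemma negative_triangle_spectrum (R : realType) :
  eigenvalue_vectors (@locally_psd R 4 2)
    (\row_(i < 4) [:: 60; 60; 0; -30]`_i).
Proof.
apply: (@row_mem_eigenvalue_vectors _ _ _
  (\matrix_(i, j) negative_triangle_entry R i j)).
- concrete_locally_psd negative_triangle_entry.
- concrete_char_poly negative_triangle_entry.
- by move=> [|[|[|[|i]]]] [|[|[|[|j]]]] //=; rewrite ?andbF // => _; lra.
Qed.

Lemma twisted_cycle_spectrum (R : realType) :
  eigenvalue_vectors (@locally_psd R 4 2)
    (\row_(i < 4) [:: 9; 9; -1; -1]`_i).
Proof.
apply: (@row_mem_eigenvalue_vectors _ _ _
  (\matrix_(i, j) twisted_cycle_entry R i j)).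
- concrete_locally_psd twisted_cycle_entry.
- concrete_char_poly twisted_cycle_entry.
- by move=> [|[|[|[|i]]]] [|[|[|[|j]]]] //=; rewrite ?andbF // => _; lra.
Qed.

Theorem theorem1p1 (R : realType) :
  ~ convex_set (M := 'rV[R]_4) (eigenvalue_vectors (@locally_psd R 4 2)).
Proof.
move=> cvx; have half_ge0 : 0 <= 2^-1 :> R by lra.
have half_le1 : 2^-1 <= 1 :> R by lra.
have := cvx _ _ (Itv01 half_ge0 half_le1)
  (mem_set (negative_triangle_spectrum R))
  (mem_set (twisted_cycle_spectrum R)).
move=> /set_mem.
rewrite [conv _ _ _](_ : _ =
   \row_(i < 4) [:: 69 / 2; 69 / 2; - 1 / 2; - 31 / 2]`_i); last first.
  by apply/rowP => -[[|[|[|[|?]]]] ?] //; rewrite !mxE /= /unstable.onem; field.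
(* Here e_4 = 147591 / 16 and e_2 = 94, so that e_2 ^+ 2 = 141376 / 16. *)
by move=> /eigenvalue_vectors44_prod_le /=; lra.
Qed.
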